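(* In the concrete model, for every $1\le j\le M$ and $u\in\mathbb{C}$ one has $T_j(u)T_j(-u)=P_j(u^2)\,\mathbb{1}$, where the polynomials $P_j\in\mathbb{C}[z]$ are given by $P_j=1$ for $j\le 0$ and, for $m\ge 1$, $$P_{2m}(z)=P_{2m-2}(z)-z\,(b_{2m-1}^2+b_{2m}^2+\bar b_{2m+1}^2)\,P_{2m-4}(z)+z^2\,b_{2m-3}^2b_{2m}^2\,(1+\beta_{2m-1}b_{2m-2}^2)^2\,P_{2m-6}(z)-z^2\,b_{2m-5}^2\,\bar b_{2m+1}^2\,P_{2m-8}(z),$$ $$P_{2m-1}(z)=P_{2m-2}(z)-z\,b_{2m-1}^2\,P_{2m-4}(z)$$ (terms whose coefficient contains a vanishing $b_i$ with $i\le0$ are zero).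
   Context: Concrete model. Fix an integer $M\ge1$ and complex numbers $b_1,\dots,b_M$. Let $h_1,\dots,h_M$ be elements of a unital associative complex algebra satisfying $h_m^2=b_m^2\mathbb{1}$, $h_mh_{m+1}=-h_{m+1}h_m$, $h_mh_{m+2}=-h_{m+2}h_m$, and $h_mh_l=h_lh_m$ for $|l-m|>2$ (e.g. $h_m=b_m\sigma^z_m\sigma^z_{m+1}\sigma^x_{m+2}$ on a spin chain). Set $h_j:=0$, $b_j:=0$ for $j\le 0$ or $j>M$. Let $\beta_3,\beta_5$ be arbitrary complex numbers and define $\beta_{2m+1}:=\beta_{2m-1}/(b_{2m-4}^2\beta_{2m-3}-b_{2m}^2\beta_{2m-1}+1)$ for $m\ge3$ (denominators assumed nonzero). For $2\le m\le\lfloor M/2\rfloor$ put $\bar h_{2m+1}:=\beta_{2m-1}h_{2m-2}h_{2m-3}h_{2m}$ and $\bar b_{2m+1}:=\beta_{2m-1}b_{2m-2}b_{2m-3}b_{2m}$ (so $\bar h_{2m+1}^2=\bar b_{2m+1}^2\mathbb{1}$); otherwise $\bar h_{2m+1}:=0$, $\bar b_{2m+1}:=0$. For $1\le j\le M$, the model of size $j$ (same couplings) has frustration graph $G_j$ with vertices $h_1,\dots,h_j$ and $\bar h_{2m+1}$ for $2\le m\le\lfloor j/2\rfloor$, and edges $h_i\sim h_l$ iff $|i-l|\in\{1,2\}$; $\bar h_{2m-1}\sim h_l$ iff $l\in\{2m-7,2m-5,2m-3,2m-1,2m-2,2m\}$; $\bar h_{2m-1}\sim\bar h_{2m'-1}$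 iff $|m-m'|=1$ (adjacent vertices anticommute, non-adjacent distinct ones commute). Charges: $Q_j^{(k)}:=\sum_{S}\prod_{v\in S}v$, the sum over independent sets $S$ of $G_j$ of size $k$ ($Q_j^{(0)}=\mathbb{1}$). Hamiltonian $H_j:=Q_j^{(1)}=\sum_{l=1}^j h_l+\sum_{m=2}^{\lfloor j/2\rfloor}\beta_{2m-1}h_{2m-2}h_{2m-3}h_{2m}$. Transfer matrix $T_j(u):=\sum_{k\ge0}(-u)^kQ_j^{(k)}$ for $u\in\mathbb{C}$, with $T_j(u):=\mathbb{1}$ for $j\le 0$. *)

(* Defs.v *)
From HB Require Import structures.
From mathcomp Require Import all_boot all_order all_algebra.
From mathcomp Require Import complex.
From mathcomp Require Import Rstruct.
Set Implicit Arguments. Unset Strict Implicit. Unset Printing Implicit Defensive.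
Import Order.TTheory GRing.Theory Num.Theory.
Local Open Scope ring_scope.

Definition C : fieldType := (Rdefinitions.R)[i].

(** Vertex labels of the frustration graphs:
    [LH l] stands for h_l, [LB m] stands for \bar h_{2m+1}. *)
Inductive lab := LH of nat | LB of nat.

Definition adj (x y : lab) : bool :=
  match x, y with
  | LH i, LH l => [|| (i - l == 1)%N, (l - i == 1)%N, (i - l == 2)%N | (l - i == 2)%N]
  | LB m, LH l | LH l, LB m =>
      l \in [:: (2 * m-5)%N; (2 * m-3)%N; (2 * m-1)%N; (2 * m)%N; (2 * m+1)%N; (2 * m+2)%N]
  | LB m, LB m' => (m - m' == 1)%N || (m' - m == 1)%N
  end.

(** Vertices of G_j: h_1..h_j (left summand, i ↦ h_{i+1}) and
    \bar h_{2m+1} for 2 <= m <= j/2 (right summand, k ↦ \bar h_{2(k+2)+1}). *)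
Definition vert (j : nat) : finType := ('I_j + 'I_(j./2 - 1))%type.

Definition vlab (j : nat) (v : vert j) : lab :=
  match v with
  | inl i => LH (i.+1)
  | inr k => LB (k.+2)
  end.

Section Model.
Variables (A : algType C) (h : nat -> A) (beta : nat -> C).

Definition lval (x : lab) : A :=
  match x with
  | LH l => h l
  | LB m => beta (2 * m-1)%N *: (h (2 * m-2)%N * h (2 * m-3)%N * h (2 * m)%N)
  end.

Definition independent (j : nat) (S : {set vert j}) : bool :=
  [forall x in S, forall y in S, ~~ adj (vlab x) (vlab y)].

Definition Qch (j k : nat) : A :=
  \sum_(S : {set vert j} | independent S && (#|S| == k))
     \prod_(v in S) lval (vlab v).

(** Transfer matrix T_j(u) = sum_{k>=0} (-u)^k Q_j^{(k)}
    (Q_j^{(k)} = 0 for k > #vertices). *)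
Definition Tmat (j : nat) (u : C) : A :=
  \sum_(0 <= k < #|vert j|.+1) (- u) ^+ k *: Qch j k.

End Model.

(** \bar b_{2m+1} (model of size M). *)
Definition bbar (M : nat) (b beta : nat -> C) (m : nat) : C :=
  if (2 <= m)%N && (m <= M./2)%N
  then beta (2 * m-1)%N * b (2 * m-2)%N * b (2 * m-3)%N * b (2 * m)%N else 0.

(* Main.v *)
Require Import Defs.
From HB Require Import structures.
From mathcomp Require Import all_boot all_order all_algebra.
From mathcomp Require Import complex Rstruct.
From mathcomp Require Import ssrAC ring zify.
Set Implicit Arguments. Unset Strict Implicit. Unset Printing Implicit Defensive.
Import Order.TTheory GRing.Theory Num.Theory.
Local Open Scope ring_scope.

(** Write E_n(u) = T_{2n}(u), k_n = \bar h_{2n+1} and y_n = 1 + beta_{2n-1} b_{2n-2}^2.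
    Deleting h_{2n}, k_n and h_{2n-1} from the frustration graph gives
      E_n = E_{n-1} - u (h_{2n-1} + h_{2n} + k_n) E_{n-2}
            + u^2 y_n h_{2n} h_{2n-3} E_{n-3} - u^2 k_n h_{2n-5} E_{n-4},
    and k_n commutes with E_{n-2} + u h_{2n-5} E_{n-4}, which yields a similar
    recursion with the coefficients on the right. Multiplying the second
    recursion for E_n(u) by the first one for E_n(-u), the diagonal terms are
    those of the recursion of P_{2n}, up to the sign of the last one, and the
    cross terms are brackets E_i(u) w E_j(-u) with w a monomial in the h_l.
    Finitely many relations between brackets, stating that certain combinations
    are symmetric or antisymmetric under the exchange of i and j, reproduce
    themselves under the recursion; they are proved by simultaneous induction
    and make the cross terms add up to the missing contribution of the
    last term. *)

(** * Brackets E_i(u) w E_j(-u) *)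

Section Brackets.

Variables (R : comNzRingType) (A : algType R) (u : R).
Variables (g : nat -> A) (c bt : nat -> R) (e f : nat -> A).

Hypothesis g_sq : forall i, g i * g i = c i *: 1.
Hypothesis g_anti : forall i j, (i < j <= i + 2)%N -> g i * g j = - (g j * g i).
Hypothesis g_comm : forall i j, (i + 2 < j)%N -> g i * g j = g j * g i.
Hypothesis e_comm : forall i j, (2 * i + 3 <= j)%N -> g j * e i = e i * g j.

Definition word k (w : seq nat) : A := \prod_(a <- w) g (a + k.*2).

Definition bracket k i w j : A := e (i + k) * word k w * f (j + k).

Hypothesis e_rec : forall k, e (4 + k)%N = e (3 + k)%N
  - u *: (e (2 + k)%N * (word k [:: 7]%N + word k [:: 8]%N + bt (4 + k) *: word k [:: 6; 5; 8]%N))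
  + (u ^+ 2 * (1 + bt (4 + k) * c (6 + k.*2))) *: (e (1 + k)%N * word k [:: 8; 5]%N)
  + (u ^+ 2 * bt (4 + k)) *: (e k * word k [:: 6; 5; 8; 3]%N).
Hypothesis f_rec : forall k, f (4 + k)%N = f (3 + k)%N
  + u *: ((word k [:: 7]%N + word k [:: 8]%N + bt (4 + k) *: word k [:: 6; 5; 8]%N) * f (2 + k)%N)
  + (u ^+ 2 * (1 + bt (4 + k) * c (6 + k.*2))) *: (word k [:: 8; 5]%N * f (1 + k)%N)
  - (u ^+ 2 * bt (4 + k)) *: (word k [:: 6; 5; 8; 3]%N * f k).

(* Formal combinations of brackets. [Br i w j] stands for
   E_{k+i}(u) * w * E_{k+j}(-u), where a letter [a] of [w] stands for h_{2k+a};
   in terms of n = k + i, the letter for h_{2n+l} is 2i + l. *)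
Inductive lincomb :=
  | Br of nat & seq nat & nat
  | Add of lincomb & lincomb
  | Sc of R & lincomb.

Fixpoint eval k t : A :=
  match t with
  | Br i w j => bracket k i w j
  | Add t1 t2 => eval k t1 + eval k t2
  | Sc a t1 => a *: eval k t1
  end.

Fixpoint shift t :=
  match t with
  | Br i w j => Br i.+1 (map S (map S w)) j.+1
  | Add t1 t2 => Add (shift t1) (shift t2)
  | Sc a t1 => Sc a (shift t1)
  end.

Lemma eval_shift k t : eval k.+1 t = eval k (shift t).
Proof.
elim: t => //= [i w j|t1 -> t2 ->|a t ->] //.
rewrite /bracket /word 2!big_map !addnS; congr (_ * _ * _).
by apply: eq_bigr => a _; rewrite doubleS !addnS.
Qed.

(* Letters of index at least 2i + 3 commute with E_i, hence can be inserted in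
   the middle of a bracket by a left multiplication. *)
Fixpoint premul v t :=
  match t with
  | Br i w j => Br i (v ++ w) j
  | Add t1 t2 => Add (premul v t1) (premul v t2)
  | Sc a t1 => Sc a (premul v t1)
  end.

Fixpoint far v t :=
  match t with
  | Br i w j => all (leq (2 * i + 3)%N) v
  | Add t1 t2 => far v t1 && far v t2
  | Sc a t1 => far v t1
  end.

Lemma eval_premul k v t : far v t -> eval k (premul v t) = word k v * eval k t.
Proof.
elim: t => /= [i w j /allP av|t1 IH1 t2 IH2 /andP[/IH1-> /IH2->]|a t IH /IH->].
- rewrite /bracket /word big_cat /= !mulrA; congr (_ * _ * _).
  elim: v av => [|a v IH] av; first by rewrite !big_nil mulr1 mul1r.
  rewrite !big_cons mulrA -e_comm; last first.
    by have := av a (mem_head _ _); lia.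
  by rewrite -!mulrA IH // => b bv; apply: av; rewrite inE bv orbT.
- by rewrite mulrDr.
- by rewrite scalerAr.
Qed.

Lemma premul_eq0 v t k : eval k t = 0 -> far v t -> eval k (premul v t) = 0.
Proof. by move=> t0 /eval_premul->; rewrite t0 mulr0. Qed.

Arguments premul_eq0 v [t k].

(** * Normal forms of words and a computational test for null combinations *)

(** The two truncated differences separate, by computation alone, equal letters, letters already in
    order, anticommuting letters (distance 1 or 2) and commuting ones. *)
Fixpoint insert k i w : R * seq nat :=
  if w is j :: w' then
    match (i - j)%N, (j - i)%N with
    | 0, 0 => (c (i + k.*2), w')
    | 0, _ => (1, i :: w)
    | 1, _ | 2, _ => let: (a, v) := insert k i w' in (- a, j :: v)
    | _, _ => let: (a, v) := insert k i w' in (a, j :: v)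
    end
  else (1, [:: i]).

Lemma insertP k i w :
  g (i + k.*2) * word k w = (insert k i w).1 *: word k (insert k i w).2.
Proof.
have wE z v : word k (z :: v) = g (z + k.*2) * word k v by rewrite /word big_cons.
elim: w => [|j w IH] /=; first by rewrite wE scale1r.
have flip b : g (i + k.*2) * g (j + k.*2) = (-1) ^+ b *: (g (j + k.*2) * g (i + k.*2)) ->
    g (i + k.*2) * word k (j :: w) =
    ((-1) ^+ b * (insert k i w).1) *: word k (j :: (insert k i w).2).
  by move=> ij; rewrite !wE mulrA ij -scalerAl -mulrA IH -scalerAr scalerA.
have near : (j < i <= j + 2)%N ->
    g (i + k.*2) * g (j + k.*2) = (-1) ^+ 1 *: (g (j + k.*2) * g (i + k.*2)).
  by move=> ij; rewrite scaleN1r [g (j + _) * _]g_anti ?opprK //; lia.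
case: (insert k i w) flip {IH} => a v /= flip.
case Dij: (i - j)%N => [|[|[|d]]]; first case Dji: (j - i)%N => [|d] /=.
- have -> : i = j by lia.
  by rewrite wE mulrA g_sq -scalerAl mul1r.
- by rewrite !wE scale1r.
- by rewrite (flip 1%N); [rewrite mulN1r | apply: near; lia].
- by rewrite (flip 1%N); [rewrite mulN1r | apply: near; lia].
- rewrite (flip 0%N) ?mul1r // scale1r [g (j + _) * _]g_comm //; lia.
Qed.

Fixpoint sort_word k w : R * seq nat :=
  if w is i :: w' then
    let: (a, v) := sort_word k w' in let: (a', v') := insert k i v in (a * a', v')
  else (1, [::]).

Lemma sort_wordP k w : word k w = (sort_word k w).1 *: word k (sort_word k w).2.
Proof.
elim: w => [|i w IH] /=; first by rewrite scale1r.
case: (sort_word k w) IH => a v /= IH.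
have := insertP k i v; case: (insert k i v) => a' v' /= insE.
by rewrite {1}/word big_cons -/(word k w) IH -scalerAr insE scalerA.
Qed.

(* [expand] and [expandr] replace E_{k+7} by its recursion: in the left factor
   the coefficients are put on its right, in the right factor on its left, so
   that they all end up in the middle word. *)
Fixpoint expand k t :=
  match t with
  | Br 7 w j =>
      Add (Br 6 w j) (Add (Sc (- u) (Add (Br 5 [:: 13 & w]%N j) (Add (Br 5 [:: 14 & w]%N j)
        (Sc (bt (7 + k)) (Br 5 [:: 12, 11, 14 & w]%N j)))))
      (Add (Sc (u ^+ 2 * (1 + bt (7 + k) * c (12 + k.*2))) (Br 4 [:: 14, 11 & w]%N j))
           (Sc (u ^+ 2 * bt (7 + k)) (Br 3 [:: 12, 11, 14, 9 & w]%N j))))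
  | Br i w j => Br i w j
  | Add t1 t2 => Add (expand k t1) (expand k t2)
  | Sc a t1 => Sc a (expand k t1)
  end.

Fixpoint expandr k t :=
  match t with
  | Br i w 7 =>
      Add (Br i w 6) (Add (Sc u (Add (Br i (w ++ [:: 13]%N) 5) (Add (Br i (w ++ [:: 14]%N) 5)
        (Sc (bt (7 + k)) (Br i (w ++ [:: 12; 11; 14]%N) 5)))))
      (Add (Sc (u ^+ 2 * (1 + bt (7 + k) * c (12 + k.*2))) (Br i (w ++ [:: 14; 11]%N) 4))
           (Sc (- (u ^+ 2 * bt (7 + k))) (Br i (w ++ [:: 12; 11; 14; 9]%N) 3))))
  | Br i w j => Br i w j
  | Add t1 t2 => Add (expandr k t1) (expandr k t2)
  | Sc a t1 => Sc a (expandr k t1)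
  end.

Lemma word_shift3 k w :
  word (3 + k) w = word k [seq (6 + a)%N | a <- w].
Proof. by rewrite /word big_map; apply: eq_bigr => a _; congr g; lia. Qed.

Lemma eval_expand k t : eval k (expand k t) = eval k t.
Proof.
elim: t => [i w j|t1 /= -> t2 ->|a t /= ->] //.
do 7 (case: i => [//|i]); case: i => //=.
rewrite /bracket (e_rec (3 + k)) !word_shift3 /=.
have -> : (6 + (3 + k).*2 = 12 + k.*2)%N by lia.
rewrite /word !(mulrDl, mulrDr, mulNr, big_cons, big_nil, mulr1, =^~ scalerAl, =^~ scalerAr,
  mulrA, scalerDr, scaleNr, addrA, opprD) /=.
by [].
Qed.

Lemma eval_expandr k t : eval k (expandr k t) = eval k t.
Proof.
elim: t => [i w j|t1 /= -> t2 ->|a t /= ->] //.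
do 7 (case: j => [//|j]); case: j => //=.
rewrite /bracket (f_rec (3 + k)) !word_shift3 /=.
have -> : (6 + (3 + k).*2 = 12 + k.*2)%N by lia.
rewrite /word !big_cat /=.
rewrite !(mulrDl, mulrDr, mulrN, big_cons, big_nil, mulr1, =^~ scalerAl, =^~ scalerAr,
  mulrA, scalerDr, scaleNr, addrA, opprD) /=.
by [].
Qed.

Fixpoint eqw (v w : seq nat) : bool :=
  match v, w with
  | [::], [::] => true
  | a :: v', b :: w' => eqn a b && eqw v' w'
  | _, _ => false
  end.

Lemma eqwP v w : eqw v w -> v = w.
Proof. by elim: v w => [|a v IH] [|b w] //= /andP[/eqnP-> /IH->]. Qed.

Fixpoint add_term a i w j (s : seq (R * nat * seq nat * nat)) :=
  match s with
  | [::] => [:: (a, i, w, j)]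
  | (a', i', w', j') :: s' =>
    if eqn i i' && (eqn j j' && eqw w w') then (a + a', i', w', j') :: s'
    else (a', i', w', j') :: add_term a i w j s'
  end.

Fixpoint normal k a t s :=
  match t with
  | Br i w j => let: (b, v) := sort_word k w in add_term (a * b) i v j s
  | Add t1 t2 => normal k a t1 (normal k a t2 s)
  | Sc b t1 => normal k (a * b) t1 s
  end.

(** Coefficients stay symbolic in [u], [bt] and [c], so this is a conjunction of equations left to
    [ring], not a boolean test. *)
Fixpoint vanishes (s : seq (R * nat * seq nat * nat)) :=
  if s is (a, _, _, _) :: s' then a = 0 /\ vanishes s' else True.

Fixpoint total k (s : seq (R * nat * seq nat * nat)) : A :=
  if s is (a, i, w, j) :: s' then a *: bracket k i w j + total k s' else 0.

Lemma total_add_term k a i w j s :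
  total k (add_term a i w j s) = a *: bracket k i w j + total k s.
Proof.
elim: s => //= -[[[b i'] w'] j'] s IH; case: ifP => [|_] /=.
  by case/and3P=> /eqnP-> /eqnP-> /eqwP->; rewrite scalerDl addrA.
by rewrite IH addrCA.
Qed.

Lemma normalP k a t s : total k (normal k a t s) = a *: eval k t + total k s.
Proof.
elim: t a s => [i w j|t1 IH1 t2 IH2|b t IH] a s /=.
- rewrite /bracket (sort_wordP k w); case: (sort_word k w) => b v /=.
  by rewrite total_add_term -scalerAr -scalerAl scalerA.
- by rewrite IH1 IH2 scalerDr addrA.
- by rewrite IH scalerA.
Qed.

(** Expansion and normalization preserve values, so [t'], a combination of known relations, is a
    certificate for [t] as soon as all coefficients of the difference vanish. *)
Lemma eq_eval k t t' : eval k t' = 0 ->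
  vanishes (normal k 1 (expandr k (expand k t)) (normal k (-1) t' [::])) ->
  eval k t = 0.
Proof.
move=> t'0 van; have := normalP k 1 (expandr k (expand k t)) (normal k (-1) t' [::]).
rewrite [in RHS]normalP t'0 eval_expandr eval_expand scaler0 scale1r !addr0 => <-.
elim: (normal _ _ _ _) van => //= -[[[a i] w] j] s IH [-> /IH->].
by rewrite scale0r addr0.
Qed.

(** * Relations between brackets *)

Definition skew i w j := Add (Br i w j) (Sc (-1) (Br j w i)).
Definition symm i w j := Add (Br i w j) (Br j w i).
(* Relations satisfied by brackets, with n = k + 4 and x_l = h_{2n+l} coded by
   the letter 8 + l. This list is closed under expansion of E_n; it was found
   by expanding the cross terms of E_{n+1}(u) E_{n+1}(-u) and splitting the
   result according to the parity in the generators not occurring in E_n. *)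
Definition swap1 := skew 4 [:: 9]%N 3.
Definition swap3 := skew 4 [:: 7; 9; 10]%N 2.
Definition swap2 := Add (skew 4 [:: 10]%N 3) (Sc u (symm 3 [:: 10; 7]%N 2)).
Definition swap2_bar k := Add (skew 4 [:: 10; 7; 8]%N 3)
  (Add (Sc (u * c (8 + k.*2)) (symm 3 [:: 10; 7]%N 2)) (Sc (- u) (skew 4 [:: 10; 7; 8; 5]%N 1))).
Definition swap1_bar k := Add (skew 4 [:: 9; 8; 7]%N 3)
  (Add (Sc (- u) (skew 4 [:: 9; 8; 7; 5]%N 1))
  (Add (Sc (- (u * c (8 + k.*2))) (symm 3 [:: 9; 7]%N 2))
       (Sc (u * c (7 + k.*2)) (symm 3 [:: 9; 8]%N 2)))).
Definition symm2 := Add (symm 4 [:: 10; 7]%N 2) (Sc (-1) (symm 3 [:: 10; 7]%N 2)).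
Definition symm1 k := Add (symm 4 [:: 9; 7]%N 2)
  (Add (Sc (-1) (symm 3 [:: 9; 7]%N 2)) (Sc (- (u * 2 * c (7 + k.*2))) (Br 2 [:: 9]%N 2))).
Definition swap_prev k := Add (skew 4 [:: 7]%N 2) (Sc (u * 2 * c (7 + k.*2)) (Br 2 [::] 2)).

(* The cross terms of E_{n+1}(u) E_{n+1}(-u) that are odd in h_{2n+2} and even
   in h_{2n+1}. *)
Definition swap_cross k := Add (skew 4 [:: 10]%N 3)
  (Add (Sc (bt (5 + k)) (skew 4 [:: 8; 7; 10]%N 3))
  (Add (Sc (u * (1 + bt (5 + k) * c (8 + k.*2))) (symm 4 [:: 10; 7]%N 2))
       (Sc (- (u * bt (5 + k))) (skew 4 [:: 8; 7; 10; 5]%N 1)))).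
Definition diag_rec k := Add (Br 4 [::] 4)
  (Add (Sc (-1) (Br 3 [::] 3))
  (Add (Sc (u ^+ 2 * (c (7 + k.*2) + c (8 + k.*2)
               + bt (4 + k) ^+ 2 * c (6 + k.*2) * c (5 + k.*2) * c (8 + k.*2))) (Br 2 [::] 2))
  (Add (Sc (- (u ^+ 4 * (c (5 + k.*2) * c (8 + k.*2) * (1 + bt (4 + k) * c (6 + k.*2)) ^+ 2)))
          (Br 1 [::] 1))
       (Sc (u ^+ 4 * (c (3 + k.*2)
               * (bt (4 + k) ^+ 2 * c (6 + k.*2) * c (5 + k.*2) * c (8 + k.*2))))
          (Br 0 [::] 0))))).

Lemma null_add k t1 t2 : eval k t1 = 0 -> eval k t2 = 0 -> eval k (Add t1 t2) = 0.
Proof. by move=> /= -> ->; rewrite addr0. Qed.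

Lemma null_sc k a t : eval k t = 0 -> eval k (Sc a t) = 0.
Proof. by move=> /= ->; rewrite scaler0. Qed.

Ltac check := cbv [eval expand expandr normal add_term vanishes sort_word insert eqw eqn
   premul shift map cat andb subn Nat.sub addn Nat.add double skew symm subn_rec addn_rec double_rec
   swap1 swap3 swap2 swap2_bar swap1_bar symm2 symm1 swap_prev
   swap_cross diag_rec]; repeat split; ring.

(** The terms [E_{n-1} w E_{n-2}] of [swap2] and of [bt (5 + k)] times [swap2_bar] add up to a
    multiple u y_{n+1}, which the same multiple of [symm2] removes. *)
Lemma swap_crossP k : eval k swap2 = 0 -> eval k (swap2_bar k) = 0 -> eval k symm2 = 0 ->
  eval k (swap_cross k) = 0.
Proof.
move=> r3 v s0.
apply: (eq_eval (null_add r3 (null_add (null_sc (bt (5 + k)) v)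
  (null_sc (u * (1 + bt (5 + k) * c (8 + k.*2))) s0)))).
check.
Qed.

(** For n = k + 7, the letter 15 is h_{2n+1}, which anticommutes with h_{2n-1} and h_{2n}. The terms
    odd in h_{2n-1} therefore combine into [swap1], the others into [swap_cross], both at n - 1. *)
Lemma swap1_step k : eval k.+2 swap1 = 0 -> eval k.+2 (swap_cross k.+2) = 0 -> eval k.+3 swap1 = 0.
Proof.
rewrite !eval_shift => r1 i2.
apply: (eq_eval (null_add (null_sc (- u) (premul_eq0 [:: 15]%N r1 isT))
  (null_sc (- u) (premul_eq0 [:: 15]%N i2 isT)))).
check.
Qed.

(** Since h_{2n+2} commutes with h_{2n-1}, the terms in h_{2n-1} survive as a symmetric combination;
    the second summand of [swap2] cancels it. *)
Lemma swap2_step k : eval k.+2 (swap_cross k.+2) = 0 -> eval k.+3 swap2 = 0.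
Proof.
rewrite !eval_shift => i2.
apply: (eq_eval (null_sc (- u) (premul_eq0 [:: 16]%N i2 isT))).
check.
Qed.

(** The contributions [E_{n-2} w E_{n-2}] cancel; those of h_{2n} h_{2n-3} and k_n h_{2n-5} are
    differences covered by the older relations. *)
Lemma symm2_step k : eval k.+1 swap1 = 0 -> eval k.+1 swap3 = 0 -> eval k.+3 symm2 = 0.
Proof.
rewrite !eval_shift => r1 i3.
apply: (eq_eval (null_add
  (null_sc (u ^+ 2 * (1 + bt (7 + k) * c (12 + k.*2))) (premul_eq0 [:: 16; 13; 14]%N r1 isT))
  (null_sc (u ^+ 2 * bt (7 + k)) (premul_eq0 [:: 16; 13; 14]%N i3 isT)))).
check.
Qed.

(** Unlike h_{2n+2}, h_{2n+1} anticommutes with h_{2n-1}, so the two squares of h_{2n-1} add up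
    instead of cancelling. *)
Lemma symm1_step k : eval k.+1 swap1 = 0 -> eval k.+1 swap3 = 0 -> eval k.+3 (symm1 k.+3) = 0.
Proof.
rewrite !eval_shift => r1 i3.
apply: (eq_eval (null_add
  (null_sc (u ^+ 2 * (1 + bt (7 + k) * c (12 + k.*2))) (premul_eq0 [:: 15; 13; 14]%N r1 isT))
  (null_sc (u ^+ 2 * bt (7 + k)) (premul_eq0 [:: 15; 13; 14]%N i3 isT)))).
check.
Qed.

Lemma swap3_step k :
  eval k.+2 swap1 = 0 -> eval k.+1 swap1 = 0 -> eval k.+1 swap3 = 0 -> eval k.+3 swap3 = 0.
Proof.
rewrite !eval_shift => r1' r1 i3.
apply: (eq_eval (null_add (null_sc (-1) (premul_eq0 [:: 15; 16]%N r1' isT)) (null_add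
  (null_sc (- (u ^+ 2 * (1 + bt (7 + k) * c (12 + k.*2))))
    (premul_eq0 [:: 13; 15; 16; 14]%N r1 isT))
  (null_sc (- (u ^+ 2 * bt (7 + k))) (premul_eq0 [:: 13; 15; 16; 14]%N i3 isT))))).
check.
Qed.

Lemma swap_prev_step k :
  eval k.+2 swap1 = 0 -> eval k.+1 swap1 = 0 -> eval k.+1 swap3 = 0 ->
  eval k.+3 (swap_prev k.+3) = 0.
Proof.
rewrite !eval_shift => r1' r1 i3.
apply: (eq_eval (null_add r1' (null_add
  (null_sc (- (u ^+ 2 * (1 + bt (7 + k) * c (12 + k.*2)))) (premul_eq0 [:: 13; 14]%N r1 isT))
  (null_sc (- (u ^+ 2 * bt (7 + k))) (premul_eq0 [:: 13; 14]%N i3 isT))))).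
check.
Qed.

(** The word itself contains h_{2n-1} and h_{2n}. Their squares contract to [c (13 + k.*2)] and
    [c (14 + k.*2)], leaving the words of [swap2], [swap1_bar] and [symm1]. *)
Lemma swap2_bar_step k :
  eval k.+2 swap2 = 0 -> eval k.+2 (swap1_bar k.+2) = 0 -> eval k.+2 (symm1 k.+2) = 0 ->
  eval k.+2 swap3 = 0 -> eval k swap1 = 0 -> eval k.+3 (swap2_bar k.+3) = 0.
Proof.
rewrite !eval_shift => r3 r4 s1 i3 r1.
apply: (eq_eval (null_add (null_sc (u * c (13 + k.*2)) (premul_eq0 [:: 16]%N r3 isT))
  (null_add (null_sc (u * c (14 + k.*2) * bt (7 + k)) (premul_eq0 [:: 16]%N r4 isT))
  (null_add (null_sc (- (u ^+ 2 * c (14 + k.*2) * (1 + bt (7 + k) * c (12 + k.*2))))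
                     (premul_eq0 [:: 16]%N s1 isT))
  (null_add (null_sc u (premul_eq0 [:: 16]%N i3 isT))
            (null_sc (- (u ^+ 3 * bt (7 + k) * c (14 + k.*2) * c (11 + k.*2)))
                     (premul_eq0 [:: 16; 13; 12]%N r1 isT))))))).
check.
Qed.

Lemma swap1_bar_step k :
  eval k.+2 (swap1_bar k.+2) = 0 -> eval k.+2 (symm1 k.+2) = 0 ->
  eval k.+2 swap3 = 0 -> eval k.+1 swap1 = 0 -> eval k swap1 = 0 -> eval k.+3 (swap1_bar k.+3) = 0.
Proof.
rewrite !eval_shift => r4 s1 i3 r1' r1.
apply: (eq_eval (null_add
  (null_sc (- (u * c (14 + k.*2) * bt (7 + k))) (premul_eq0 [:: 15]%N r4 isT))
  (null_add (null_sc (u ^+ 2 * c (14 + k.*2) * (1 + bt (7 + k) * c (12 + k.*2)))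
                     (premul_eq0 [:: 15]%N s1 isT))
  (null_add (null_sc (- u) (premul_eq0 [:: 15]%N i3 isT))
  (null_add (null_sc (u ^+ 2 * c (13 + k.*2)) (premul_eq0 [:: 15; 14]%N r1' isT))
            (null_sc (u ^+ 3 * bt (7 + k) * c (14 + k.*2) * c (11 + k.*2))
                     (premul_eq0 [:: 15; 13; 12]%N r1 isT))))))).
check.
Qed.

(** The certificate follows the parity of the cross terms in h_{2n-1} and h_{2n}, with n = k + 7.
    Its last relation treats k_n against k_n h_{2n-5}, and its term in [E_{n-4} E_{n-4}] reverses
    the sign of the last diagonal term. *)
Lemma diag_rec_step k :
  eval k.+2 swap1 = 0 -> eval k.+2 (swap_cross k.+2) = 0 -> eval k.+1 swap1 = 0 ->
  eval k.+1 swap3 = 0 -> eval k.+1 swap2 = 0 -> eval k.+1 (swap_prev k.+1) = 0 ->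
  eval k.+3 (diag_rec k.+3) = 0.
Proof.
rewrite !eval_shift => r1' i2 r1 i3 r3 r7.
apply: (eq_eval (null_add (null_sc u r1') (null_add (null_sc u i2)
  (null_add (null_sc (- (u ^+ 3 * (1 + bt (7 + k) * c (12 + k.*2))))
                     (premul_eq0 [:: 13; 14]%N r1 isT))
  (null_add (null_sc (- (u ^+ 3 * (1 + bt (7 + k) * c (12 + k.*2)) * c (14 + k.*2))) r1)
  (null_add (null_sc (- (u ^+ 3 * bt (7 + k) * (1 + bt (7 + k) * c (12 + k.*2))
                        * c (14 + k.*2) * c (11 + k.*2))) r3)
  (null_add (null_sc (- (u ^+ 3 * bt (7 + k))) (premul_eq0 [:: 13; 14]%N i3 isT))
  (null_add (null_sc (- (u ^+ 3 * bt (7 + k) * c (14 + k.*2))) i3)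
            (null_sc (u ^+ 3 * (bt (7 + k) ^+ 2 * c (12 + k.*2) * c (11 + k.*2)
                     * c (14 + k.*2))) r7))))))))).
check.
Qed.

(** * Simultaneous induction on the relations *)

Hypothesis g_small : forall i, (i <= 14)%N -> g i = 0.
Hypothesis c_small : forall i, (i <= 14)%N -> c i = 0.

(* The zero padding makes all the relations trivial for k <= 2. *)
Definition invariant k :=
  [/\ eval k swap1 = 0, eval k swap3 = 0, eval k swap2 = 0 & eval k (swap2_bar k) = 0] /\
  [/\ eval k (swap1_bar k) = 0, eval k symm2 = 0, eval k (symm1 k) = 0 & eval k (swap_prev k) = 0].

Lemma word_eq0 k w : has (fun a => a + k.*2 <= 14)%N w -> word k w = 0.
Proof.
elim: w => //= a w IH; rewrite /word big_cons => /orP[/g_small->|/IH w0].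
  by rewrite mul0r.
by rewrite -/(word k w) w0 mulr0.
Qed.

Lemma invariantP k : invariant k.
Proof.
elim/ltn_ind: k => -[|[|[|k]]] IH; last first.
  have [[r1 i3 r3 v] [r4 s0 s1 r7]] := IH k.+2 (ltnSn _).
  have [[r1' i3' r3' _] _] := IH k.+1 ltac:(lia).
  have [[r1'' _ _ _] _] := IH k ltac:(lia).
  have i2 := swap_crossP r3 v s0.
  do 2 split.
  - exact: swap1_step.
  - exact: swap3_step.
  - exact: swap2_step.
  - exact: swap2_bar_step.
  - exact: swap1_bar_step.
  - exact: symm2_step.
  - exact: symm1_step.
  - exact: swap_prev_step.
(* The largest letter is 10 and k <= 2, so all indices are at most 14, where [g] vanishes. The empty
   word only occurs with coefficient a multiple of [c (7 + k.*2)], also 0. *)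
all: do 2 split; rewrite /= /bracket ?c_small // ?(mulr0, oppr0, scale0r);
  by rewrite !word_eq0 // ?(mulr0, mul0r, scaler0, addr0).
Qed.

(** For n = k + 4, this cancels the cross terms of the transfer matrix of odd size, E_n - u h_{2n+1}
    E_{n-1}, multiplied by its value at -u. *)
Lemma bracket_swap k :
  e (4 + k)%N * g (9 + k.*2) * f (3 + k)%N = e (3 + k)%N * g (9 + k.*2) * f (4 + k)%N.
Proof.
have [[+ _ _ _] _] := invariantP k.
by rewrite /= /bracket /word !big_seq1 scaleN1r => /subr0_eq.
Qed.

Lemma bracket_diag k : e (7 + k)%N * f (7 + k)%N = e (6 + k)%N * f (6 + k)%N
  - (u ^+ 2 * (c (13 + k.*2) + c (14 + k.*2)
       + bt (7 + k) ^+ 2 * c (12 + k.*2) * c (11 + k.*2) * c (14 + k.*2)))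
    *: (e (5 + k)%N * f (5 + k)%N)
  + (u ^+ 4 * (c (11 + k.*2) * c (14 + k.*2) * (1 + bt (7 + k) * c (12 + k.*2)) ^+ 2))
    *: (e (4 + k)%N * f (4 + k)%N)
  - (u ^+ 4 * (c (9 + k.*2)
       * (bt (7 + k) ^+ 2 * c (12 + k.*2) * c (11 + k.*2) * c (14 + k.*2))))
    *: (e (3 + k)%N * f (3 + k)%N).
Proof.
have [[r1 i3 r3 v] [r4 s0 s1 r7]] := invariantP k.+2.
have [[r1' i3' r3' _] [_ _ _ r7']] := invariantP k.+1.
have i2 := swap_crossP r3 v s0.
have := diag_rec_step r1 i2 r1' i3' r3' r7'.
rewrite eval_shift eval_shift eval_shift /= /bracket /word !big_nil !mulr1.
rewrite scaleN1r !scaleNr => /eqP; rewrite addr_eq0 => /eqP->.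
by rewrite !(opprD, opprK) !addrA.
Qed.

End Brackets.

(** * Independence polynomials *)

Definition lab_sum x := match x with LH i => inl i | LB m => inr m end.
Definition sum_lab x := match x with inl i => LH i | inr m => LB m end.
Lemma lab_sumK : cancel lab_sum sum_lab. Proof. by case. Qed.
HB.instance Definition _ := Equality.copy lab (can_type lab_sumK).

Lemma eq_LH i j : (LH i == LH j) = (i == j). Proof. by []. Qed.
Lemma eq_LB i j : (LB i == LB j) = (i == j). Proof. by []. Qed.
Lemma eq_LHB i j : (LH i == LB j) = false. Proof. by []. Qed.
Lemma eq_LBH i j : (LB i == LH j) = false. Proof. by []. Qed.
Definition eq_lab := (eq_LH, eq_LB, eq_LHB, eq_LBH).

Lemma adjC x y : adj x y = adj y x.
Proof. case: x y => [i|m] [j|n] //=; lia. Qed.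

Lemma adjxx x : adj x x = false.
Proof. case: x => i /=; lia. Qed.

Lemma filter_swap (T : Type) (p q : pred T) s :
  [seq x <- [seq x <- s | q x] | p x] = [seq x <- [seq x <- s | p x] | q x].
Proof. by rewrite -!filter_predI; apply: eq_filter => x /=; rewrite andbC. Qed.

Section IndependencePolynomial.

Variables (R : comNzRingType) (A : algType R) (u : R).
Implicit Type val : lab -> A.

(** With lists, deleting the head vertex needs no commutation; independence of the order is
    recovered in [eq_ipoly]. *)
Fixpoint indep_lists (s : seq lab) : seq (seq lab) :=
  if s is x :: s' then
    indep_lists s' ++ [seq x :: t | t <- indep_lists s' & all (fun y => ~~ adj x y) t]
  else [:: [::]].

Definition ipoly val s : A :=
  \sum_(t <- indep_lists s) (- u) ^+ size t *: \prod_(x <- t) val x.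

Lemma indep_lists_filter p s :
  [seq t <- indep_lists s | all p t] = indep_lists [seq x <- s | p x].
Proof.
elim: s => //= x s IH; rewrite filter_cat filter_map -filter_predI IH.
have [px|npx] := boolP (p x).
  rewrite /= -IH -!filter_predI; congr (_ ++ map _ _).
  by apply: eq_filter => t /=; rewrite px andbC.
rewrite [X in _ ++ map _ X](_ : _ = [::]) ?cats0 //.
by elim: (indep_lists s) => //= t r ->; rewrite (negPf npx).
Qed.

Lemma ipoly0 val : ipoly val [::] = 1.
Proof. by rewrite /ipoly big_seq1 big_nil scale1r. Qed.

Lemma ipoly_cons val x s : ipoly val (x :: s) =
  ipoly val s - u *: (val x * ipoly val [seq y <- s | ~~ adj x y]).
Proof.
rewrite /ipoly /= big_cat big_map /= indep_lists_filter mulr_sumr -scaleNr scaler_sumr.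
by congr (_ + _); apply: eq_bigr => t _; rewrite big_cons exprS -scalerA scalerAr.
Qed.

Lemma ipoly_drop0 val p s : (forall x, x \in s -> ~~ p x -> val x = 0) ->
  ipoly val s = ipoly val [seq x <- s | p x].
Proof.
have [n] := ubnP (size s); elim: n s => // n IH [|x s] //= lt_sn v0.
have vs y : y \in s -> ~~ p y -> val y = 0 by move=> sy; apply: v0; rewrite inE sy orbT.
have [px|npx] := boolP (p x); last by rewrite ipoly_cons IH // v0 ?mem_head // mul0r scaler0 subr0.
rewrite !ipoly_cons IH // [in X in _ - X]IH; first by rewrite filter_swap.
  by rewrite size_filter (leq_ltn_trans (count_size _ _)).
by move=> y; rewrite mem_filter => /andP[_ /vs].
Qed.

Lemma eq_ipoly_map (val val' : lab -> A) (sh : lab -> lab) s :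
  {in s, forall x, val' (sh x) = val x} -> {in s &, forall x y, adj (sh x) (sh y) = adj x y} ->
  ipoly val' (map sh s) = ipoly val s.
Proof.
have [n] := ubnP (size s); elim: n s => [|n IH] [|x s] //= lt_sn vE adjE.
  by rewrite !ipoly0.
have sub r : {subset r <= s} -> (size r < n)%N -> ipoly val' (map sh r) = ipoly val r.
  move=> rs rn; apply: IH => //; first by move=> y /rs ys; apply: vE; rewrite inE ys orbT.
  by move=> y z /rs ys /rs zs; apply: adjE; rewrite inE ?ys ?zs orbT.
rewrite !ipoly_cons vE ?mem_head // filter_map sub //
  -(sub [seq y <- s | ~~ adj x y]); last 2 first.
- by move=> y; rewrite mem_filter => /andP[].
- by rewrite size_filter (leq_ltn_trans (count_size _ _)).
congr (_ - _ *: (_ * ipoly _ (map _ _))).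
apply: eq_in_filter => y sy /=; rewrite adjE ?mem_head // inE sy orbT //.
Qed.

Variable val : lab -> A.
Hypothesis val_comm : forall x y, ~~ adj x y -> val x * val y = val y * val x.

Lemma ipoly_comm a s : {in s, forall x, a * val x = val x * a} ->
  a * ipoly val s = ipoly val s * a.
Proof.
have [n] := ubnP (size s); elim: n s => [|n IH] [|x s] //= lt_sn ax.
  by rewrite ipoly0 mulr1 mul1r.
have sub r : {subset r <= s} -> (size r < n)%N -> a * ipoly val r = ipoly val r * a.
  by move=> rs rn; apply: IH => // y /rs ys; apply: ax; rewrite inE ys orbT.
rewrite ipoly_cons mulrBr mulrBl sub // -scalerAr -scalerAl mulrA ax ?mem_head //.
rewrite -!mulrA sub //; first by move=> y; rewrite mem_filter => /andP[].
by rewrite size_filter (leq_ltn_trans (count_size _ _)).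
Qed.

(** Induction on the head a. If a and x are adjacent, no independent set contains both; otherwise
    their values commute and the two deletions can be exchanged. *)
Lemma ipoly_del x s : uniq s -> x \in s ->
  ipoly val s = ipoly val [seq y <- s | y != x]
     - u *: (val x * ipoly val [seq y <- s | (y != x) && ~~ adj x y]).
Proof.
have [n] := ubnP (size s); elim: n s => // n IH [|a s] //= lt_sn /andP[nas us].
rewrite inE; case: (eqVneq x a) nas => [<- nas _|ne_xa nas /= sx].
  have nx y : y \in s -> y != x by apply: contraTneq => ->.
  rewrite /= ipoly_cons; congr (ipoly _ _ - _ *: (_ * ipoly _ _)).
    by apply/esym/all_filterP/allP => y /nx.
  by apply: eq_in_filter => y /nx->.
have ne_ax : a != x by rewrite eq_sym.
have IHs := IH s lt_sn us sx.
rewrite ipoly_cons /= ipoly_cons IHs (adjC x a).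
have [adj_ax|nadj_ax] /= := boolP (adj a x).
  have -> : [seq y <- [seq y <- s | y != x] | ~~ adj a y] = [seq y <- s | ~~ adj a y].
    rewrite -filter_predI; apply: eq_filter => y /=.
    by case: eqVneq => [->|]; rewrite ?adj_ax ?andbT.
  by rewrite addrAC.
have usr : uniq [seq y <- s | ~~ adj a y] by rewrite filter_uniq.
have sxr : x \in [seq y <- s | ~~ adj a y] by rewrite mem_filter nadj_ax.
have ltr : (size [seq y <- s | ~~ adj a y] < n)%N.
  by rewrite size_filter (leq_ltn_trans (count_size _ _)).
rewrite (IH _ ltr usr sxr) !(filter_swap _ (fun y => ~~ adj a y)) ipoly_cons.
set X := ipoly _ _; set Y := ipoly _ _; set Z := ipoly _ _; set W := ipoly _ _.
rewrite !mulrBr !scalerBr -!scalerAr !mulrA (val_comm nadj_ax) !opprB.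
by rewrite ![_ + (_ - _)]addrA ![X - _ + _]addrAC [LHS]addrAC.
Qed.

Lemma eq_ipoly r t : uniq r -> uniq t -> r =i t -> ipoly val r = ipoly val t.
Proof.
have [n] := ubnP (size r); elim: n r t => // n IH [|a r] t /= lt_rn.
  by case: t => // a t _ _ /(_ a); rewrite in_nil mem_head.
case/andP=> nar ur ut rt.
have ta : a \in t by rewrite -rt mem_head.
have rtE y : (y \in r) = (y != a) && (y \in t).
  by rewrite -rt inE; case: eqVneq => // ->; rewrite (negPf nar).
rewrite ipoly_cons (ipoly_del ut ta); congr (_ - _ *: (_ * _)); apply: IH;
  rewrite ?filter_uniq ?size_filter ?(leq_ltn_trans (count_size _ _)) // => y.
  by rewrite mem_filter rtE.
by rewrite !mem_filter rtE andbCA andbA.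
Qed.

(** Describing the smaller graphs by membership reduces each use to arithmetic on labels. *)
Lemma ipoly_step x s s1 s2 : uniq s -> uniq s1 -> uniq s2 -> x \in s ->
  (forall y, (y \in s1) = (y != x) && (y \in s)) ->
  (forall y, (y \in s2) = [&& y != x, ~~ adj x y & y \in s]) ->
  ipoly val s = ipoly val s1 - u *: (val x * ipoly val s2).
Proof.
move=> us us1 us2 sx s1E s2E; rewrite (ipoly_del us sx).
congr (_ - _ *: (_ * _)); apply: eq_ipoly; rewrite ?filter_uniq // => y.
  by rewrite mem_filter s1E.
by rewrite mem_filter s2E andbA.
Qed.

End IndependencePolynomial.

(** * Vertex lists, and the transfer matrix as an independence polynomial *)

(** The two bounds are independent because successive deletions pass through graphs that are no
    G_j. *)
Definition labels h n := [seq LH i | i <- iota 1 h] ++ [seq LB m | m <- iota 2 n.-1].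

Lemma mem_labels h n x :
  (x \in labels h n) = match x with LH i => (0 < i <= h)%N | LB m => (1 < m <= n)%N end.
Proof.
have injH : injective LH by move=> ? ? [].
have injB : injective LB by move=> ? ? [].
rewrite mem_cat; case: x => [i|m].
  rewrite (mem_map injH) mem_iota orbC; case: mapP => [[? _]|_] //; rewrite /=; lia.
rewrite (mem_map injB) mem_iota; case: mapP => [[? _]|_] //; rewrite /=; lia.
Qed.

Lemma labels_uniq h n : uniq (labels h n).
Proof.
rewrite cat_uniq !map_inj_uniq ?iota_uniq ?andbT /=; try by move=> ? ? [].
by apply/hasPn => x /mapP[m _ ->]; apply/mapP => -[].
Qed.

(** Induction for all [F] at once: the sets containing the head [a] are reindexed as [a |: S], which
    changes the summand. *)
Lemma sum_independent (T : finType) (lb : T -> lab) (V : nmodType) (F : seq lab -> V) (s : seq T) :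
  uniq s ->
  \sum_(S : {set T} | [forall x in S, forall y in S, ~~ adj (lb x) (lb y)] && (S \subset s))
     F [seq lb v | v <- s & v \in S] = \sum_(t <- indep_lists (map lb s)) F t.
Proof.
pose indep (S : {set T}) := [forall x in S, forall y in S, ~~ adj (lb x) (lb y)].
have indepP (S : {set T}) : reflect {in S &, forall x y, ~~ adj (lb x) (lb y)} (indep S).
  apply: (iffP forall_inP) => [SS x y xS|SS x xS]; first by move/forall_inP: (SS x xS); apply.
  by apply/forall_inP => y; apply: SS.
elim: s F => [|a s IH] F /=.
  move=> _; rewrite big_seq1 (big_pred1 set0) => [|S]; first by [].
  apply/andP/eqP => [[_ /subsetP S0]|->]; first by apply/setP => x; rewrite inE; apply/negP => /S0.
  by split; [apply/forall_inP => x; rewrite inE | apply/subsetP => x; rewrite inE].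
case/andP=> nas us; rewrite big_cat big_map big_filter /=.
rewrite (bigID (fun S : {set T} => a \notin S)) /=; congr (_ + _).
  rewrite -IH //; apply: eq_big => [S|S /andP[_ /negPf->] //].
  rewrite -andbA; congr (_ && _).
  apply/andP/subsetP => [[/subsetP Ss aS] x xS|Ss].
    by have := Ss x xS; rewrite inE; case: eqP => // xa; rewrite -xa xS in aS.
  split; last by apply: contra nas => /Ss.
  by apply/subsetP => x /Ss; rewrite inE => ->; rewrite orbT.
rewrite [RHS]big_mkcond /=.
rewrite -(IH (fun t => if all (fun y => ~~ adj (lb a) y) t then F (lb a :: t) else 0)) //.
rewrite -big_mkcondr /= (reindex_onto (fun S => a |: S) (fun S => S :\ a)) /=; last first.
  by move=> S /andP[_]; rewrite negbK => /setD1K.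
apply: eq_big => [S|S].
  rewrite !inE eqxx.
  have [aS|naS] := boolP (a \in S).
    rewrite (negPf (_ : (a |: S) :\ a != S)) ?andbF; last first.
      by apply: contraL aS => /eqP<-; rewrite !inE eqxx.
    by apply/esym; apply: contraNF nas => /andP[/andP[_ /subsetP->]].
  rewrite setU1K // eqxx !andbT -andbA [in RHS]andbC -andbA.
  have -> : (a |: S \subset a :: s) = (S \subset s).
    apply/subsetP/subsetP => [Ss x xS|Ss x]; last first.
      by rewrite !inE => /predU1P[->|/Ss->]; rewrite ?eqxx ?orbT.
    have := Ss x; rewrite !inE xS orbT => /(_ isT) /predU1P[xa|//].
    by rewrite -xa xS in naS.
  rewrite andbC; have [Ss|] := boolP (S \subset s); rewrite //= ?andbF //.
  apply/(sameP (indepP _))/(iffP andP) => [[/allP aS /indepP SS] x y|SS].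
    have aS' y' : y' \in S -> ~~ adj (lb a) (lb y').
      by move=> yS; apply/aS/map_f; rewrite mem_filter yS (subsetP Ss).
    rewrite !inE => /predU1P[->|xS] /predU1P[->|yS].
    - by rewrite adjxx.
    - exact: aS'.
    - by rewrite adjC aS'.
    - exact: SS.
  split; last by apply/indepP => x y xS yS; apply: SS; rewrite !inE ?xS ?yS orbT.
  apply/allP => _ /mapP[y + ->]; rewrite mem_filter => /andP[yS _].
  by apply: SS; rewrite !inE ?eqxx ?yS ?orbT.
move=> _; rewrite !inE eqxx /=; congr (F (_ :: map _ _)).
apply: eq_in_filter => x xs; rewrite !inE; case: eqP => // xa.
by rewrite -xa xs in nas.
Qed.

Lemma TmatE (A : algType C) (h : nat -> A) beta j u :
  (forall x y, ~~ adj x y -> lval h beta x * lval h beta y = lval h beta y * lval h beta x) ->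
  Tmat h beta j u = ipoly u (lval h beta) (labels j j./2).
Proof.
move=> val_comm; rewrite /Tmat /Qch big_mkord.
under eq_bigr => k _ do rewrite scaler_sumr.
rewrite (exchange_big_dep (fun S : {set vert j} => independent S)) /=; last first.
  by move=> k S _ /andP[].
pose F t : A := (- u) ^+ size t *: \prod_(x <- t) lval h beta x.
transitivity (\sum_(S : {set vert j} | independent S && (S \subset index_enum (vert j)))
   F [seq vlab v | v <- index_enum (vert j) & v \in S]).
  apply: eq_big => [S|S indepS].
    by rewrite (introT subsetP) ?andbT // => x _; rewrite mem_index_enum.
  have ltS : (#|S| < #|vert j|.+1)%N by rewrite ltnS max_card.
  (* Each S contributes to the single degree k = #|S|. *)
  rewrite (big_pred1 (Ordinal ltS)) => [|k]; last by rewrite indepS /= eq_sym.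
  rewrite /F big_map big_filter size_map size_filter -sum1_count sum1_card.
  by [].
rewrite sum_independent ?index_enum_uniq //; apply: (eq_ipoly _ val_comm).
- rewrite map_inj_uniq ?index_enum_uniq // => -[i|k] [i'|k'] //= [].
    by move/val_inj->.
  by move/val_inj->.
- exact: labels_uniq.
move=> x; rewrite mem_labels; apply/mapP/idP => [[[i|k] _ ->] /=|].
- exact: ltn_ord.
- by have := ltn_ord k; lia.
case: x => [[//|i]|[|[|m]]//] /= lt_x.
  by exists (inl (Ordinal lt_x)); rewrite ?mem_index_enum.
have lt_m : (m < j./2 - 1)%N by lia.
by exists (inr (Ordinal lt_m)); rewrite ?mem_index_enum.
Qed.

Lemma adj_LH i j : adj (LH i) (LH j) = [&& i != j, i <= j + 2 & j <= i + 2]%N.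
Proof. rewrite /=; lia. Qed.

Lemma adj_LHB l m : adj (LH l) (LB m) =
  [|| l == 2 * m - 5, l == 2 * m - 3, l == 2 * m - 1, l == 2 * m, l == 2 * m + 1
    | l == 2 * m + 2]%N.
Proof. by rewrite /= !inE. Qed.

(** * Commutation of the vertices and recursions for E_n *)

Section Model.

Variables (A : algType C) (g : nat -> A) (c beta : nat -> C).
Hypothesis g_sq : forall i, g i * g i = c i *: 1.
Hypothesis g_anti : forall i j, (i < j <= i + 2)%N -> g i * g j = - (g j * g i).
Hypothesis g_comm : forall i j, (i + 2 < j)%N -> g i * g j = g j * g i.
Hypothesis g0 : g 0 = 0.

Let val := lval g beta.

Lemma LH_comm i j : ~~ adj (LH i) (LH j) -> g i * g j = g j * g i.
Proof.
move=> /=; case: (ltngtP i j) => [ij|ji|-> //] nadj.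
  by apply: g_comm; lia.
by apply/esym/g_comm; lia.
Qed.

Lemma LH_anti i j : i != j -> adj (LH i) (LH j) -> g i * g j = - (g j * g i).
Proof.
move=> /=; case: (ltngtP i j) => // ij _ adj_ij; first by apply: g_anti; lia.
by rewrite [g j * _]g_anti ?opprK //; lia.
Qed.

Lemma triple_comm (a b d x : A) (s1 s2 s3 : bool) :
  x * a = (-1) ^+ s1 *: (a * x) -> x * b = (-1) ^+ s2 *: (b * x) ->
  x * d = (-1) ^+ s3 *: (d * x) ->
  x * (a * b * d) = (-1) ^+ (s1 (+) s2 (+) s3) *: (a * b * d * x).
Proof.
move=> xa xb xd; rewrite !signr_addb -!mulrA mulrA xa -scalerAl -!mulrA.
rewrite [x * (b * d)]mulrA xb -scalerAl -!mulrA xd -!scalerAr !scalerA.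
by rewrite mulrA.
Qed.

Lemma g_sign i j : g i * g j = (-1) ^+ (adj (LH i) (LH j) : nat) *: (g j * g i).
Proof.
have [->|ne_ij] := eqVneq i j.
  by rewrite adjxx scale1r.
have [/LH_anti-> //|/LH_comm->] := boolP (adj _ _); last by rewrite scale1r.
by rewrite scaleN1r.
Qed.

(** The sign between h_l and k_m only depends on the parity of the number of factors of k_m
    anticommuting with h_l. *)
Definition par l m := adj (LH l) (LH (2 * m - 2)) (+) adj (LH l) (LH (2 * m - 3))
  (+) adj (LH l) (LH (2 * m)).

Lemma g_bar_sign l m : g l * val (LB m) = (-1) ^+ (par l m : nat) *: (val (LB m) * g l).
Proof.
by rewrite /= -scalerAr (triple_comm (g_sign _ _) (g_sign _ _) (g_sign _ _)) -scalerAl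
  !scalerA mulrC.
Qed.

Lemma val_LB01 m : (m <= 1)%N -> val (LB m) = 0.
Proof. by case: m => [|[|//]] _; rewrite /= !(g0, mul0r, scaler0). Qed.

Lemma lval_comm x y : ~~ adj x y -> val x * val y = val y * val x.
Proof.
have LHB l m : ~~ adj (LH l) (LB m) -> g l * val (LB m) = val (LB m) * g l.
  have [m_le1 _|m_gt1] := leqP m 1; first by rewrite val_LB01 // mulr0 mul0r.
  rewrite g_bar_sign => nadj; rewrite (_ : par l m = false) ?scale1r //.
  (* In the outer cases h_l commutes with all three factors of k_m; for l = 2m - 4 and l = 2m - 2 it
     anticommutes with exactly two. *)
  have far : (l + 6 <= 2 * m \/ l + 4 = 2 * m \/ l + 2 = 2 * m \/ 2 * m + 3 <= l)%N.
    by move: nadj; rewrite adj_LHB; lia.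
  rewrite /par !adj_LH; by case: far => [|[|[|]]] far; lia.
case: x y => [i|m] [j|n]; first exact: LH_comm.
- exact: LHB.
- by rewrite adjC => /LHB.
move=> nadj; wlog lt_mn : m n nadj / (m < n)%N => [wlt|].
  have [/wlt->//|gt|-> //] := ltngtP m n.
  by apply/esym/wlt; rewrite // adjC.
have [m_le1|m_gt1] := leqP m 1; first by rewrite val_LB01 // mulr0 mul0r.
have sgn l : val (LB m) * g l = (-1) ^+ (par l m : nat) *: (g l * val (LB m)).
  by rewrite g_bar_sign scalerA -signr_addb addbb scale1r.
rewrite [val (LB n)]/= -scalerAr (triple_comm (sgn _) (sgn _) (sgn _)) -scalerAl.
rewrite (_ : _ (+) _ = false) ?scale1r //.
have gt : (m + 2 <= n)%N by move: nadj => /=; lia.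
have par_far l : (2 * m + 3 <= l)%N -> par l m = false by rewrite /par !adj_LH; lia.
have par_near l : (2 * m < l <= 2 * m + 2)%N -> par l m = true by rewrite /par !adj_LH; lia.
have [gt2|lt2|eq2] := ltngtP (m + 2)%N n.
- by rewrite !par_far //; lia.
- lia.
(* For n = m + 2, the factors h_{2m+2} and h_{2m+1} of k_n both anticommute with k_m, and the signs
   cancel. *)
- by rewrite (par_near (2 * n - 2)%N) ?(par_near (2 * n - 3)%N) ?(par_far (2 * n)%N) //; lia.
Qed.

(** The vector [p] arises twice, from h_{2n} h_{2n-3} and from k_n h_{2n-2}; together they give the
    factor y_n. *)
Lemma collect_terms (V : lmodType C) (u t s : C) (x a b d p q : V) :
  x - u *: a - u *: (t *: (b + u *: d - (u * s) *: p)) - u *: (q - u *: p) =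
  x - u *: (a + q + t *: b) + (u ^+ 2 * (1 + t * s)) *: p - (u ^+ 2 * t) *: d.
Proof.
rewrite !(scalerBr, scalerDr, scalerA) !(opprB, opprD) !addrA.
rewrite (_ : u ^+ 2 * (1 + t * s) = u * u + u * t * (u * s)); last by ring.
rewrite (_ : u ^+ 2 * t = u * t * u); last by ring.
rewrite scalerDl !addrA.
by rewrite [LHS](ACl (1 * 2 * 7 * 4 * 6 * 3 * 5)).
Qed.

Section Recursion.

Variable u : C.
Let Z := ipoly u val.

(* E_n = T_{2n} *)
Definition even_transfer n := ipoly u val (labels n.*2 n).
Let e := even_transfer.

Lemma labels_step x h1 n1 h2 n2 h3 n3 : x \in labels h1 n1 ->
  (forall y, (y \in labels h2 n2) = (y != x) && (y \in labels h1 n1)) ->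
  (forall y, (y \in labels h3 n3) = [&& y != x, ~~ adj x y & y \in labels h1 n1]) ->
  Z (labels h1 n1) = Z (labels h2 n2) - u *: (val x * Z (labels h3 n3)).
Proof. by apply: ipoly_step; rewrite ?labels_uniq //; exact: lval_comm. Qed.

Ltac labels_tac := case=> [i|m];
  rewrite ?mem_labels 1?in_cons ?mem_labels 1?in_cons ?mem_labels 1?in_cons ?mem_labels
    ?eq_lab ?(adjC (LB _) (LH _)) ?adj_LH ?adj_LHB; try lia; rewrite /=; lia.

Lemma odd_transferE k : Z (labels (7 + k.*2) (3 + k)) =
  e (3 + k) - u *: (g (7 + k.*2) * e (2 + k)).
Proof.
rewrite /e /even_transfer; apply: (@labels_step (LH (7 + k.*2)));
  [rewrite mem_labels; lia | |]; labels_tac.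
Qed.

(* G_{2n-4} without h_{2n-5}, for n = k + 4. None of its vertices is adjacent
   to \bar h_{2n+1}, so the right-hand side commutes with \bar h_{2n+1},
   although neither summand does. *)
Lemma bar_neighbourhood k : Z (LH (4 + k.*2) :: labels (2 + k.*2) (2 + k)) =
  e (2 + k) + u *: (g (3 + k.*2) * e k).
Proof.
rewrite (_ : e (2 + k) = Z (LH (4 + k.*2) :: labels (2 + k.*2) (2 + k))
  - u *: (g (3 + k.*2) * e k)) ?subrK // /e /even_transfer.
apply: (@ipoly_step _ _ u _ lval_comm (LH (3 + k.*2))).
- exact: labels_uniq.
- rewrite cons_uniq labels_uniq mem_labels; lia.
- exact: labels_uniq.
- rewrite mem_labels; lia.
- labels_tac.
- labels_tac.
Qed.

Lemma even_transfer_raw k :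
  e (4 + k) = e (3 + k) - u *: (g (7 + k.*2) * e (2 + k))
    - u *: (val (LB (4 + k)) * (e (2 + k) + u *: (g (3 + k.*2) * e k)
                                 - u *: (g (6 + k.*2) * e (1 + k))))
    - u *: (g (8 + k.*2) * (e (2 + k) - u *: (g (5 + k.*2) * e (1 + k)))).
Proof.
have odd1 : Z (labels (5 + k.*2) (2 + k)) = e (2 + k) - u *: (g (5 + k.*2) * e (1 + k)).
  rewrite /e /even_transfer; apply: (@labels_step (LH (5 + k.*2)));
    [rewrite mem_labels; lia | |]; labels_tac.
(* For n = 4 + k, these are the vertices not adjacent to k_n: h_{2n-2} and those of
   [bar_neighbourhood]. *)
have bar : Z (LH (6 + k.*2) :: LH (4 + k.*2) :: labels (2 + k.*2) (2 + k)) =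
    e (2 + k) + u *: (g (3 + k.*2) * e k) - u *: (g (6 + k.*2) * e (1 + k)).
  rewrite -bar_neighbourhood; apply: (@ipoly_step _ _ u _ lval_comm (LH (6 + k.*2))).
  - rewrite 2!cons_uniq labels_uniq in_cons !mem_labels eq_lab; lia.
  - rewrite cons_uniq labels_uniq mem_labels; lia.
  - exact: labels_uniq.
  - exact: mem_head.
  - labels_tac.
  - labels_tac.
have bars : Z (labels (7 + k.*2) (4 + k)) =
    Z (labels (7 + k.*2) (3 + k)) - u *: (val (LB (4 + k)) *
      Z (LH (6 + k.*2) :: LH (4 + k.*2) :: labels (2 + k.*2) (2 + k))).
  apply: (@ipoly_step _ _ u _ lval_comm (LB (4 + k))).
  - exact: labels_uniq.
  - exact: labels_uniq.
  - rewrite 2!cons_uniq labels_uniq in_cons !mem_labels eq_lab; lia.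
  - rewrite mem_labels; lia.
  - labels_tac.
  - labels_tac.
rewrite -odd1 -bar -odd_transferE -bars.
apply: (@labels_step (LH (8 + k.*2))); [rewrite mem_labels; lia | |]; labels_tac.
Qed.

Lemma even_transfer_comm i j : (2 * i + 3 <= j)%N -> g j * e i = e i * g j.
Proof.
move=> le_ij; apply: ipoly_comm => x; rewrite mem_labels => xi.
apply: (lval_comm (x := LH j)); case: x xi => [l|m] xi; rewrite ?adj_LH ?adj_LHB; lia.
Qed.

Definition bar_coef n := beta (2 * n - 1).

Lemma val_bar k : val (LB (4 + k)) = bar_coef (4 + k) *: word g k [:: 6; 5; 8]%N.
Proof.
rewrite /word !big_cons big_nil mulr1 /= mulrA; congr (_ *: (g _ * g _ * g _)); lia.
Qed.

Lemma bar_mul6 k : word g k [:: 6; 5; 8; 6]%N = c (6 + k.*2) *: word g k [:: 8; 5]%N.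
Proof.
rewrite (sort_wordP g_sq g_anti g_comm k [:: 6; 5; 8; 6]%N)
  (sort_wordP g_sq g_anti g_comm k [:: 8; 5]%N).
by rewrite /= scalerA; congr (_ *: _); ring.
Qed.

(** Among the factors of k_n, for n = 4 + k, only h_{2n-3} anticommutes with h_{2n-5}. This sign
    distinguishes the last terms of the two recursions. *)
Lemma bar_mul3 k : word g k [:: 3; 6; 5; 8]%N = - word g k [:: 6; 5; 8; 3]%N.
Proof.
rewrite (sort_wordP g_sq g_anti g_comm k [:: 3; 6; 5; 8]%N)
  (sort_wordP g_sq g_anti g_comm k [:: 6; 5; 8; 3]%N).
by rewrite /= -scaleNr; congr (_ *: _); ring.
Qed.

Lemma even_transfer_left k : e (4 + k) = e (3 + k)
  - u *: ((word g k [:: 7]%N + word g k [:: 8]%N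
      + bar_coef (4 + k) *: word g k [:: 6; 5; 8]%N) * e (2 + k))
  + (u ^+ 2 * (1 + bar_coef (4 + k) * c (6 + k.*2))) *: (word g k [:: 8; 5]%N * e (1 + k))
  - (u ^+ 2 * bar_coef (4 + k)) *: (word g k [:: 6; 5; 8; 3]%N * e k).
Proof.
have w1 a : word g k [:: a] = g (a + k.*2) by rewrite /word big_seq1.
have w3 a : word g k [:: 6; 5; 8]%N * g (a + k.*2) = word g k [:: 6; 5; 8; a].
  by rewrite /word !big_cons !big_nil !mulr1 !mulrA.
have w2 : g (8 + k.*2) * g (5 + k.*2) = word g k [:: 8; 5]%N.
  by rewrite /word !big_cons !big_nil !mulr1.
rewrite even_transfer_raw val_bar !w1 !mulrDl -![(_ *: word _ _ _) * _]scalerAl.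
rewrite -collect_terms.
congr (_ - _ *: (_ *: _) - _ *: _); last by rewrite mulrBr -scalerAr mulrA w2.
by rewrite mulrBr mulrDr -!scalerAr !mulrA !w3 bar_mul6 -scalerAl scalerA.
Qed.

Lemma even_transfer_right k : e (4 + k) = e (3 + k)
  - u *: (e (2 + k) * (word g k [:: 7]%N + word g k [:: 8]%N
      + bar_coef (4 + k) *: word g k [:: 6; 5; 8]%N))
  + (u ^+ 2 * (1 + bar_coef (4 + k) * c (6 + k.*2))) *: (e (1 + k) * word g k [:: 8; 5]%N)
  + (u ^+ 2 * bar_coef (4 + k)) *: (e k * word g k [:: 6; 5; 8; 3]%N).
Proof.
have w1 a : word g k [:: a] = g (a + k.*2) by rewrite /word big_seq1.
have w3 a : word g k [:: 6; 5; 8]%N * g (a + k.*2) = word g k [:: 6; 5; 8; a]%N.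
  by rewrite /word !big_cons !big_nil !mulr1 !mulrA.
have w3' : g (3 + k.*2) * word g k [:: 6; 5; 8]%N = word g k [:: 3; 6; 5; 8]%N.
  by rewrite /word !big_cons !big_nil !mulr1 !mulrA.
have w2 : g (8 + k.*2) * g (5 + k.*2) = word g k [:: 8; 5]%N.
  by rewrite /word !big_cons !big_nil !mulr1.
have cw : word g k [:: 8; 5]%N * e (1 + k) = e (1 + k) * word g k [:: 8; 5]%N.
  rewrite -w2 -mulrA even_transfer_comm; last by lia.
  by rewrite !mulrA even_transfer_comm //; lia.
have bar_comm : val (LB (4 + k)) * (e (2 + k) + u *: (g (3 + k.*2) * e k)) =
    (e (2 + k) + u *: (g (3 + k.*2) * e k)) * val (LB (4 + k)).
  rewrite -bar_neighbourhood; apply: ipoly_comm => x.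
  rewrite in_cons mem_labels => x_near; apply: lval_comm; move: x_near.
  by case: x => [l|m]; rewrite !eq_lab ?(adjC (LB _) (LH _)) ?adj_LHB; [|rewrite /=]; lia.
rewrite even_transfer_raw mulrBr bar_comm val_bar !w1 ![e (2 + k) * (_ + _)]mulrDr
  -![_ * (_ *: word _ _ _)]scalerAr.
rewrite -[e k * word _ _ _]opprK scalerN -collect_terms.
rewrite !(even_transfer_comm (i := 2 + k)); try lia.
congr (_ - _ *: _ - _ *: _ - _ *: _).
- rewrite [(_ + _) * _]mulrDl -!scalerAl -scalerAr mulrA w3 bar_mul6 -[(_ *: _) * _]scalerAl cw.
  rewrite [g _ * e k]even_transfer_comm; last by lia.
  by rewrite -mulrA w3' bar_mul3 mulrN [RHS]scalerBr -!scalerA.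
- rewrite mulrBr -scalerAr mulrA w2 cw even_transfer_comm //; lia.
Qed.

End Recursion.

End Model.

(* Shifting h by 14 places makes the recursions uniform: no index is truncated,
   and the initial transfer matrices are 1. *)
Section Padding.

Variables (A : algType C) (h : nat -> A) (beta : nat -> C).

Definition pad_h i := h (i - 14).
Definition pad_beta i := beta (i - 14).

Hypothesis h0 : h 0 = 0.
Hypothesis val_comm : forall x y, ~~ adj x y ->
  lval pad_h pad_beta x * lval pad_h pad_beta y = lval pad_h pad_beta y * lval pad_h pad_beta x.

Lemma pad_h_small i : (i <= 14)%N -> pad_h i = 0.
Proof. by rewrite /pad_h => /eqP->. Qed.

Lemma pad_lval_small x : (match x with LH i => i <= 14 | LB m => m <= 8 end)%N ->
  lval pad_h pad_beta x = 0.
Proof.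
case: x => [i|m] /= le; first exact: pad_h_small.
by rewrite (@pad_h_small (2 * m - 2)) ?mul0r ?scaler0 //; lia.
Qed.

(** The shift is 14 for h but 7 for k, since k_m involves h_{2m}. The label m = 8 vanishes too, as
    its factor h_{2m-2} has index 14. *)
Lemma ipoly_pad u j n :
  ipoly u (lval h beta) (labels j n) = ipoly u (lval pad_h pad_beta) (labels (14 + j) (7 + n)).
Proof.
pose sh x := match x with LH i => LH (14 + i) | LB m => LB (7 + m) end.
pose big x := match x with LH i => 14 < i | LB m => 8 < m end%N.
rewrite [RHS](ipoly_drop0 _ (p := big)); last first.
  by move=> [i|m] _ small; apply: pad_lval_small; move: small; rewrite -leqNgt.
rewrite -(eq_ipoly_map _ (sh := sh) (val' := lval pad_h pad_beta)).
- have sh_inj : injective sh by move=> [i|m] [i'|m'] //= [] /addnI->.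
  apply: (eq_ipoly _ val_comm); rewrite ?map_inj_uniq ?filter_uniq ?labels_uniq // => y.
  rewrite mem_filter mem_labels; apply/mapP/idP => [[x + ->]|].
    by rewrite mem_labels; case: x => [i|m] /=; lia.
  case: y => [i|m] /= lt_y.
    by exists (LH (i - 14)); rewrite ?mem_labels /=; [lia | congr LH; lia].
  by exists (LB (m - 7)); rewrite ?mem_labels /=; [lia | congr LB; lia].
- move=> [i|m]; rewrite mem_labels /= => lt_x; first by rewrite /pad_h addKn.
  by rewrite /pad_h /pad_beta; congr (beta _ *: (h _ * h _ * h _)); lia.
- move=> [i|m] [i'|m']; rewrite !mem_labels => lt_x lt_y;
    rewrite /sh ?(adjC (LB _) (LH _)) ?adj_LH ?adj_LHB ?[adj (LB _) (LB _)]/=; lia.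
Qed.

End Padding.

Lemma even_transfer_small (A : algType C) (h : nat -> A) beta u n : h 0%N = 0 -> (n <= 7)%N ->
  even_transfer (pad_h h) (pad_beta beta) u n = 1.
Proof.
move=> h0 le_n7; rewrite /even_transfer (ipoly_drop0 _ (p := pred0)).
  by rewrite filter_pred0 ipoly0.
by move=> x; rewrite mem_labels => lt_x _; apply: pad_lval_small => //; case: x lt_x => [i|m]; lia.
Qed.

(** * The product formula for even and odd sizes *)

Unset Implicit Arguments.

Theorem theorem3 (M : nat) (b beta : nat -> C) (A : algType C) (h : nat -> A)
  (P : nat -> {poly C}) :
  (1 <= M)%N ->
  (* conventions: b_j = 0, h_j = 0 for j <= 0 or j > M *)
  b 0%N = 0 -> (forall l, (M < l)%N -> b l = 0) ->
  h 0%N = 0 -> (forall l, (M < l)%N -> h l = 0) ->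
  (* algebra relations *)
  (forall m, (1 <= m <= M)%N -> h m * h m = (b m ^+ 2) *: 1) ->
  (forall m, (1 <= m)%N -> (m + 1 <= M)%N -> h m * h (m + 1)%N = - (h (m + 1)%N * h m)) ->
  (forall m, (1 <= m)%N -> (m + 2 <= M)%N -> h m * h (m + 2)%N = - (h (m + 2)%N * h m)) ->
  (forall m l, (1 <= m)%N -> (l <= M)%N -> (m + 2 < l)%N -> h m * h l = h l * h m) ->
  (* beta_{2m+1} recursion for m >= 3, with nonzero denominators *)
  (forall m, (3 <= m)%N ->
     b (2 * m-4)%N ^+ 2 * beta (2 * m-3)%N - b (2 * m)%N ^+ 2 * beta (2 * m-1)%N + 1 != 0) ->
  (forall m, (3 <= m)%N ->
     beta (2 * m+1)%N = beta (2 * m-1)%N /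
       (b (2 * m-4)%N ^+ 2 * beta (2 * m-3)%N - b (2 * m)%N ^+ 2 * beta (2 * m-1)%N + 1)) ->
  (* the polynomials P_j (P_j = 1 for j <= 0; truncated nat subtraction
     sends negative indices to 0) *)
  P 0%N = 1 ->
  (forall m, (1 <= m)%N ->
     P (2 * m)%N = P (2 * m-2)%N
       - 'X * (b (2 * m-1)%N ^+ 2 + b (2 * m)%N ^+ 2 + bbar M b beta m ^+ 2)%:P * P (2 * m-4)%N
       + 'X ^+ 2 * (b (2 * m-3)%N ^+ 2 * b (2 * m)%N ^+ 2
                     * (1 + beta (2 * m-1)%N * b (2 * m-2)%N ^+ 2) ^+ 2)%:P * P (2 * m-6)%N
       - 'X ^+ 2 * (b (2 * m-5)%N ^+ 2 * bbar M b beta m ^+ 2)%:P * P (2 * m-8)%N) ->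
  (forall m, (1 <= m)%N ->
     P (2 * m-1)%N = P (2 * m-2)%N - 'X * (b (2 * m-1)%N ^+ 2)%:P * P (2 * m-4)%N) ->
  forall (j : nat) (u : C), (1 <= j <= M)%N ->
    Tmat h beta j u * Tmat h beta j (- u) = (P j).[u ^+ 2] *: 1.
Proof.
move=> _ b0 b_big h0 h_big h_sq h_anti1 h_anti2 h_comm _ _ P0 Peven Podd j u /andP[j_gt0 _].
(* The zero conventions extend the algebra relations to all indices. *)
have{h_sq} h_sq i : h i * h i = (b i ^+ 2) *: 1.
  have [->|i_neq0] := eqVneq i 0%N; first by rewrite h0 b0 mul0r expr0n scale0r.
  have [big|le_iM] := ltnP M i; last by apply: h_sq; lia.
  by rewrite h_big // b_big // mul0r expr0n scale0r.
have{h_anti1 h_anti2} h_anti i l : (i < l <= i + 2)%N -> h i * h l = - (h l * h i).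
  move=> near; have [->|i_neq0] := eqVneq i 0%N; first by rewrite h0 mul0r mulr0 oppr0.
  have [big|le_lM] := ltnP M l; first by rewrite (h_big l) // mul0r mulr0 oppr0.
  have [lE|lE] : (l = i + 1 \/ l = i + 2)%N by lia.
    by rewrite lE; apply: h_anti1; lia.
  by rewrite lE; apply: h_anti2; lia.
have{} h_comm i l : (i + 2 < l)%N -> h i * h l = h l * h i.
  move=> far; have [->|i_neq0] := eqVneq i 0%N; first by rewrite h0 mul0r mulr0.
  have [big|le_lM] := ltnP M l; first by rewrite (h_big l) // mul0r mulr0.
  by apply: h_comm; lia.
pose g := pad_h h; pose bt := pad_beta beta; pose c i := b (i - 14)%N ^+ 2.
have g_small i : (i <= 14)%N -> g i = 0 by apply: pad_h_small.
have c_small i : (i <= 14)%N -> c i = 0 by rewrite /c => /eqP->; rewrite b0 expr0n.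
have g_sq i : g i * g i = c i *: 1 by apply: h_sq.
have g_anti i l : (i < l <= i + 2)%N -> g i * g l = - (g l * g i).
  move=> near; have [small|i_gt] := leqP i 14; last by apply: h_anti; lia.
  by rewrite g_small // mul0r mulr0 oppr0.
have g_comm i l : (i + 2 < l)%N -> g i * g l = g l * g i.
  move=> far; have [small|i_gt] := leqP i 14; last by apply: h_comm; lia.
  by rewrite g_small // mul0r mulr0.
have val_comm := @lval_comm _ _ bt g_anti g_comm (g_small 0%N isT).
rewrite !TmatE; try by apply: lval_comm.
rewrite !(ipoly_pad h0 val_comm).
pose e := even_transfer g bt u; pose f := even_transfer g bt (- u).
have g0 : g 0%N = 0 by apply: g_small.
have e_comm i l : (2 * i + 3 <= l)%N -> g l * e i = e i * g l.
  exact: even_transfer_comm.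
have e_rec k := even_transfer_right bt g_sq g_anti g_comm g0 u k.
have f_rec k := even_transfer_left bt g_sq g_anti g_comm g0 (- u) k.
have {}f_rec k : f (4 + k)%N = f (3 + k)%N
    + u *: ((word g k [:: 7]%N + word g k [:: 8]%N
      + bar_coef bt (4 + k) *: word g k [:: 6; 5; 8]%N) * f (2 + k)%N)
    + (u ^+ 2 * (1 + bar_coef bt (4 + k) * c (6 + k.*2)%N)) *: (word g k [:: 8; 5]%N * f (1 + k)%N)
    - (u ^+ 2 * bar_coef bt (4 + k)) *: (word g k [:: 6; 5; 8; 3]%N * f k).
  by have := f_rec k; rewrite scaleNr opprK sqrrN.
have swap k := bracket_swap g_sq g_anti g_comm e_comm e_rec f_rec g_small c_small k.
have diag k := bracket_diag g_sq g_anti g_comm e_comm e_rec f_rec g_small c_small k.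
(* For n <= 7 truncation gives P_0 = 1 on the right, and the padded transfer matrices are 1. *)
have ef n : e n * f n = (P (2 * (n - 7))%N).[u ^+ 2] *: 1.
  elim/ltn_ind: n => n IH; have [n_small|n_gt7] := leqP n 7.
    rewrite /e /f !even_transfer_small // mulr1 (_ : 2 * (n - 7) = 0)%N ?P0 ?hornerC ?scale1r //.
    lia.
  have [k nE] : exists k, n = (7 + k.+1)%N by exists (n - 8)%N; lia.
  (* Where [bbar] is 0 by convention, the product vanishes as well: b_0 = 0 when k = 0, and b_{2k+2}
     = 0 when 2k + 2 > M. *)
  have bbarE : bbar M b beta k.+1 ^+ 2 =
      bar_coef bt (7 + k.+1) ^+ 2 * c (12 + k.+1.*2)%N * c (11 + k.+1.*2)%N * c (14 + k.+1.*2)%N.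
    rewrite /bbar /bar_coef /bt /pad_beta /c.
    have -> : (2 * (7 + k.+1) - 1 - 14 = 2 * k.+1 - 1)%N by lia.
    have -> : (12 + k.+1.*2 - 14 = 2 * k.+1 - 2)%N by lia.
    have -> : (11 + k.+1.*2 - 14 = 2 * k.+1 - 3)%N by lia.
    have -> : (14 + k.+1.*2 - 14 = 2 * k.+1)%N by lia.
    case: ifP => [_|out]; first by rewrite !exprMn.
    have [k0|k_gt0] := posnP k; first by rewrite k0 b0; ring.
    by rewrite (b_big (2 * k.+1)%N) ?expr0n ?mulr0 //; lia.
  rewrite nE diag !IH; try lia.
  rewrite !scalerA -scalerBl -scalerDl -scalerBl; congr (_ *: 1).
  have -> : (2 * (7 + k.+1 - 7) = 2 * k.+1)%N by lia.
  rewrite -bbarE (Peven k.+1) // !(hornerD, hornerN, hornerM, hornerXn, hornerX, hornerC).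
  have -> : (2 * (6 + k.+1 - 7) = 2 * k.+1 - 2)%N by lia.
  have -> : (2 * (5 + k.+1 - 7) = 2 * k.+1 - 4)%N by lia.
  have -> : (2 * (4 + k.+1 - 7) = 2 * k.+1 - 6)%N by lia.
  have -> : (2 * (3 + k.+1 - 7) = 2 * k.+1 - 8)%N by lia.
  rewrite /c /bar_coef /bt /pad_beta.
  have -> : (9 + k.+1.*2 - 14 = 2 * k.+1 - 5)%N by lia.
  have -> : (11 + k.+1.*2 - 14 = 2 * k.+1 - 3)%N by lia.
  have -> : (12 + k.+1.*2 - 14 = 2 * k.+1 - 2)%N by lia.
  have -> : (13 + k.+1.*2 - 14 = 2 * k.+1 - 1)%N by lia.
  have -> : (14 + k.+1.*2 - 14 = 2 * k.+1)%N by lia.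
  have -> : (2 * (7 + k.+1) - 1 - 14 = 2 * k.+1 - 1)%N by lia.
  ring.
have [odd_j|even_j] := boolP (odd j); last first.
  have [m jE] : exists m, j = (2 * m)%N by exists j./2; lia.
  have := ef (7 + m)%N; rewrite /e /f /even_transfer jE addKn => <-.
  by have [-> ->] : ((7 + m).*2 = 14 + 2 * m /\ 7 + m = 7 + (2 * m)./2)%N by lia.
have [m jE] : exists m, j = (2 * m + 1)%N by exists j./2; lia.
have -> : (14 + j = 7 + (4 + m).*2)%N by lia.
have -> : (7 + j./2 = 3 + (4 + m))%N by lia.
(* Without padding, T_{2m+1} is E_m - u h_{2m+1} E_{m-1}. The cross terms cancel by [sw], and the
   square of h_{2m+1} gives the last term of P_{2m+1}. *)
rewrite !odd_transferE // scaleNr opprK -/e -/f.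
have sw : e (7 + m)%N * g (7 + (4 + m).*2)%N * f (6 + m)%N =
          e (6 + m)%N * g (7 + (4 + m).*2)%N * f (7 + m)%N.
  by have := swap (3 + m)%N; rewrite (_ : 9 + (3 + m).*2 = 7 + (4 + m).*2)%N //; lia.
have gE : g (7 + (4 + m).*2)%N * e (6 + m)%N = e (6 + m)%N * g (7 + (4 + m).*2)%N.
  by apply: e_comm; lia.
rewrite mulrDr !mulrBl -!scalerAr -!scalerAl !mulrA sw gE -mulrA.
rewrite addrA subrK -[e _ * g _ * _]mulrA g_sq -scalerAr mulr1 -scalerAl !scalerA.
rewrite (ef (7 + m)%N) (ef (6 + m)%N) scalerA -scalerBl; congr (_ *: 1).
have -> : j = (2 * m.+1 - 1)%N by lia.
rewrite Podd // !(hornerD, hornerN, hornerM, hornerX, hornerC) /c.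
have -> : (7 + (4 + m).*2 - 14 = 2 * m.+1 - 1)%N by lia.
have -> : (2 * (7 + m - 7) = 2 * m.+1 - 2)%N by lia.
have -> : (2 * (6 + m - 7) = 2 * m.+1 - 4)%N by lia.
ring.
Qed.
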